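(* The following representation holds: $$\frac{1}{\pi}=\frac{3}{8}\left(1-\sum_{i=1}^{\infty}\frac{1}{(2i-1)(i+1)}\left(\frac{(2i-1)!!}{(2i)!!}\right)^2\right).$$
   Context: Here $n!!$ denotes the double factorial, so $(2i-1)!!=1\cdot3\cdots(2i-1)$ and $(2i)!!=2\cdot4\cdots(2i)$. *)

(* Defs.v *)
From Stdlib Require Import Reals.
From Coquelicot Require Import Coquelicot.

(** Double factorial [n!! = n (n-2) (n-4) ...], with [0!! = 1!! = 1]. *)
Fixpoint double_fact (n : nat) : nat :=
  match n with
  | 0 => 1
  | 1 => 1
  | S (S m as p) => S p * double_fact m
  end.

Open Scope R_scope.

(** Meaningful for [1 <= i] only: the natural subtraction [2 * i - 1] truncates
    at [i = 0]. *)
Definition inv_pi_term (i : nat) : R :=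
  1 / ((2 * INR i - 1) * (INR i + 1))
  * (INR (double_fact (2 * i - 1)) / INR (double_fact (2 * i))) ^ 2.

(* Main.v *)
(** The term is Gosper-summable: writing [w i] for the squared ratio of double
    factorials, [w i / ((2 i - 1) (i + 1))] is the forward difference of
    [- 4/3 * i (4 i - 1) / (2 i - 1) * w i].  The series from [i = 0] (whose
    first term is [-1]) therefore tends to [- 8/3 * lim (i * w i)], and Wallis'
    formula says that [i * w i] tends to [1 / PI]. *)
Require Import Defs.
From Stdlib Require Import Reals Lra Lia.
From Coquelicot Require Import Coquelicot.
Open Scope R_scope.

Definition wallis_int (n : nat) : R := RInt (fun x => sin x ^ n) 0 (PI / 2).

Lemma continuous_sin_pow (n : nat) (x : R) : continuous (fun t => sin t ^ n) x.
Proof.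
apply (ex_derive_continuous (fun t => sin t ^ n)); auto_derive; auto.
Qed.

Lemma ex_RInt_sin_pow (n : nat) (a b : R) : ex_RInt (fun t => sin t ^ n) a b.
Proof.
apply (ex_RInt_continuous (V := R_CompleteNormedModule)).
intros z _; apply continuous_sin_pow.
Qed.

(** The function [cos x * sin x ^ (n + 1)] vanishes at both endpoints, and by [cos^2 = 1 - sin^2]
    its derivative is the difference [g] of the two integrands. *)
Lemma wallis_int_rec (n : nat) :
  INR (n + 2) * wallis_int (n + 2) = INR (n + 1) * wallis_int n.
Proof.
set (g := fun x => INR (n + 1) * sin x ^ n - INR (n + 2) * sin x ^ (n + 2)).
assert (H : is_RInt g 0 (PI / 2)
              (minus (cos (PI / 2) * sin (PI / 2) ^ (n + 1))
                     (cos 0 * sin 0 ^ (n + 1)))).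
{ apply (is_RInt_derive (fun x => cos x * sin x ^ (n + 1))).
  - intros x _; auto_derive; [auto|].
    unfold g; rewrite !plus_INR, !pow_add.
    replace (pred (n + 1)) with n by lia.
    simpl; generalize (sin2_cos2 x); unfold Rsqr; intros E.
    replace (cos x * (1 * cos x * ((INR n + 1) * sin x ^ n)))
      with ((cos x * cos x) * ((INR n + 1) * sin x ^ n)) by ring.
    replace (cos x * cos x) with (1 - sin x * sin x) by lra; ring.
  - intros x _; apply (ex_derive_continuous g); unfold g; auto_derive; auto. }
assert (H' : is_RInt g 0 (PI / 2)
   (INR (n + 1) * wallis_int n - INR (n + 2) * wallis_int (n + 2))).
{ apply (is_RInt_minus (V := R_NormedModule));
  apply (is_RInt_scal (V := R_NormedModule));
  apply (RInt_correct (V := R_CompleteNormedModule)), ex_RInt_sin_pow. }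
apply (is_RInt_unique (V := R_CompleteNormedModule)) in H, H'.
rewrite H in H'; revert H'.
rewrite cos_PI2, sin_0, pow_i by lia.
unfold minus, plus, opp; simpl; lra.
Qed.

Lemma wallis_int_decr (n : nat) : wallis_int (S n) <= wallis_int n.
Proof.
assert (HP := PI_RGT_0).
apply RInt_le; [lra | apply ex_RInt_sin_pow | apply ex_RInt_sin_pow |].
intros x Hx; simpl.
assert (0 <= sin x) by (apply sin_ge_0; lra).
assert (0 <= sin x ^ n) by (apply pow_le; assumption).
generalize (SIN_bound x); nra.
Qed.

Lemma wallis_int_0 : wallis_int 0 = PI / 2.
Proof.
unfold wallis_int; simpl; rewrite RInt_const; unfold scal; simpl.
unfold mult; simpl; lra.
Qed.

Lemma wallis_int_1 : wallis_int 1 = 1.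
Proof.
apply is_RInt_unique.
replace 1 with (minus (- cos (PI / 2)) (- cos 0))
  by (rewrite cos_PI2, cos_0; unfold minus, plus, opp; simpl; lra).
apply (is_RInt_derive (fun x => - cos x)).
- intros x _; auto_derive; [auto | ring].
- intros x _; apply continuous_sin_pow.
Qed.

(** At [n = 0] the truncated subtraction yields [0!! / 0!! = 1], in accordance with the convention
    [(-1)!! = 1]; the recurrence in [n] thus already holds from [0]. *)
Definition double_fact_ratio (n : nat) : R :=
  INR (double_fact (2 * n - 1)) / INR (double_fact (2 * n)).

Lemma double_fact_SS (n : nat) :
  double_fact (S (S n)) = (S (S n) * double_fact n)%nat.
Proof. reflexivity. Qed.

Lemma double_fact_pos (n : nat) : 0 < INR (double_fact n).
Proof.
apply lt_0_INR.
(* The recursion descends by two, so the induction carries two consecutive values. *)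
enough (0 < double_fact n /\ 0 < double_fact (S n))%nat by tauto.
induction n as [|n [H1 H2]]; [simpl; lia|].
split; [exact H2|]; rewrite double_fact_SS; nia.
Qed.

Lemma double_fact_ratio_pos (n : nat) : 0 < double_fact_ratio n.
Proof. apply Rdiv_lt_0_compat; apply double_fact_pos. Qed.

Lemma double_fact_ratio_0 : double_fact_ratio 0 = 1.
Proof. unfold double_fact_ratio; simpl; lra. Qed.

Lemma double_fact_ratio_S (n : nat) :
  double_fact_ratio (S n)
  = (2 * INR n + 1) / (2 * INR n + 2) * double_fact_ratio n.
Proof.
unfold double_fact_ratio.
assert (E : double_fact (2 * S n - 1)
            = ((2 * n + 1) * double_fact (2 * n - 1))%nat).
(* The case [n = 0], where [2 * n - 1] truncates, holds by computation. *)
{ destruct n as [|n]; [reflexivity|].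
  replace (2 * S (S n) - 1)%nat with (S (S (2 * S n - 1))) by lia.
  rewrite double_fact_SS; f_equal; lia. }
rewrite E; replace (2 * S n)%nat with (S (S (2 * n))) by lia.
rewrite double_fact_SS, !mult_INR, plus_INR, !S_INR, mult_INR; simpl (INR 2).
simpl (INR 0).
generalize (double_fact_pos (2 * n)) (pos_INR n); intros; field; lra.
Qed.

Lemma wallis_int_even (n : nat) :
  wallis_int (2 * n) = PI / 2 * double_fact_ratio n.
Proof.
induction n as [|n IH].
{ rewrite double_fact_ratio_0; simpl (2 * 0)%nat; rewrite wallis_int_0; ring. }
generalize (wallis_int_rec (2 * n)) (pos_INR n).
replace (2 * S n)%nat with (2 * n + 2)%nat by lia.
rewrite IH, double_fact_ratio_S, !plus_INR, mult_INR; simpl (INR 2).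
simpl (INR 1); intros E Hn.
apply (Rmult_eq_reg_l (2 * INR n + 2)); [|lra].
replace (2 * INR n + 2) with ((1 + 1) * INR n + (1 + 1)) at 1 by ring.
rewrite E; field; lra.
Qed.

Lemma wallis_int_odd (n : nat) :
  (2 * INR n + 1) * double_fact_ratio n * wallis_int (2 * n + 1) = 1.
Proof.
induction n as [|n IH].
{ rewrite double_fact_ratio_0; simpl (2 * 0 + 1)%nat.
  rewrite wallis_int_1; simpl; ring. }
generalize (wallis_int_rec (2 * n + 1)) (pos_INR n).
replace (2 * S n + 1)%nat with (2 * n + 1 + 2)%nat by lia.
rewrite double_fact_ratio_S, S_INR, !plus_INR, mult_INR; simpl (INR 2).
simpl (INR 1); intros E Hn.
etransitivity; [|exact IH].
transitivity ((2 * INR n + 1) / (2 * INR n + 2) * double_fact_ratio n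
  * (((1 + 1) * INR n + 1 + (1 + 1)) * wallis_int (2 * n + 1 + 2))); [ring|].
rewrite E; field; lra.
Qed.

(** Multiplying [wallis_int (2 * n + 1) <= wallis_int (2 * n)] by [(2 n + 1) v], with [v] the ratio
    at [n], turns the left side into [1] and the right side into [(2 n + 1) v^2 PI / 2]. *)
Lemma wallis_lower (n : nat) :
  / PI * (1 - / (2 * INR n + 1)) <= INR n * double_fact_ratio n ^ 2.
Proof.
assert (HP := PI_RGT_0); assert (Hn := pos_INR n).
assert (Hv := double_fact_ratio_pos n).
assert (Ho := wallis_int_odd n).
assert (Hd := wallis_int_decr (2 * n)).
replace (S (2 * n)) with (2 * n + 1)%nat in Hd by lia.
rewrite wallis_int_even in Hd.
set (v := double_fact_ratio n) in *.
assert (H : 1 <= (2 * INR n + 1) * v * (PI / 2 * v)).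
{ rewrite <- Ho at 1; apply Rmult_le_compat_l; [|assumption].
  apply Rmult_le_pos; lra. }
(* The last factor is the quantity that [H] bounds below by [1]. *)
replace (INR n * v ^ 2) with
  (/ PI * (2 * INR n / (2 * INR n + 1)) * ((2 * INR n + 1) * v * (PI / 2 * v)))
  by (field; lra).
replace (1 - / (2 * INR n + 1)) with (2 * INR n / (2 * INR n + 1))
  by (field; lra).
rewrite <- (Rmult_1_r (/ PI * _)) at 1.
apply Rmult_le_compat_l; [|assumption].
apply Rmult_le_pos; [left; apply Rinv_0_lt_compat; lra|].
apply Rdiv_le_0_compat; lra.
Qed.

(** The same multiplier is applied one index later, to [wallis_int (2 * n + 2) <= wallis_int (2 * n
    + 1)]. *)
Lemma wallis_upper (n : nat) : INR n * double_fact_ratio n ^ 2 <= / PI.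
Proof.
assert (HP := PI_RGT_0); assert (Hn := pos_INR n).
assert (Hv := double_fact_ratio_pos n).
assert (Ho := wallis_int_odd n).
assert (Hd := wallis_int_decr (2 * n + 1)).
replace (S (2 * n + 1)) with (2 * S n)%nat in Hd by lia.
rewrite wallis_int_even, double_fact_ratio_S in Hd.
set (v := double_fact_ratio n) in *.
assert (H : (2 * INR n + 1) * v
            * (PI / 2 * ((2 * INR n + 1) / (2 * INR n + 2) * v)) <= 1).
{ eapply Rle_trans; [|right; exact Ho]; apply Rmult_le_compat_l; [|assumption].
  apply Rmult_le_pos; lra. }
apply (Rmult_le_reg_l PI); [lra|]; rewrite Rinv_r by lra.
eapply Rle_trans; [|exact H].
(* This uses [(2 n + 1)^2 / (4 (n + 1)) = n + 1 / (4 (n + 1))]; the remainder is nonnegative and is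
   dropped. *)
replace ((2 * INR n + 1) * v * (PI / 2 * ((2 * INR n + 1) / (2 * INR n + 2) * v)))
  with (PI * (INR n * v ^ 2) + PI * v ^ 2 / (4 * (INR n + 1)))
  by (field; lra).
enough (0 <= PI * v ^ 2 / (4 * (INR n + 1))) by lra.
apply Rdiv_le_0_compat; [|lra].
apply Rmult_le_pos; [lra | apply pow2_ge_0].
Qed.

(** Needed for [b = 1] in the lower Wallis bound and for [b = -1] in the partial sums. *)
Lemma is_lim_seq_inv_affine (b : R) :
  is_lim_seq (fun n => / (2 * INR n + b)) 0.
Proof.
apply (is_lim_seq_inv _ p_infty); [|discriminate].
eapply is_lim_seq_plus; [|apply is_lim_seq_const|].
- eapply is_lim_seq_mult; [apply is_lim_seq_const | apply is_lim_seq_INR |].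
  apply (is_Rbar_mult_sym p_infty), is_Rbar_mult_p_infty_pos; simpl; lra.
- reflexivity.
Qed.

Lemma wallis_limit :
  is_lim_seq (fun n => INR n * double_fact_ratio n ^ 2) (/ PI).
Proof.
apply (is_lim_seq_le_le (fun n => / PI * (1 - / (2 * INR n + 1))) _
         (fun _ => / PI)).
- intros n; split; [apply wallis_lower | apply wallis_upper].
- replace (/ PI) with (/ PI * (1 - 0)) at 1 by ring.
  apply is_lim_seq_mult'; [apply is_lim_seq_const|].
  apply is_lim_seq_minus'; [apply is_lim_seq_const|].
  apply is_lim_seq_inv_affine.
- apply is_lim_seq_const.
Qed.

(** The sum covers [i = 1] to [n + 1], so it telescopes to the antidifference at [n + 2] minus its
    value [-1] at [1]. The factor [(4 i - 1) / (2 i - 1)] is written [2 + 1 / (2 i - 1)] to make its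
    limit visible. *)
Lemma sum_inv_pi_term (n : nat) :
  sum_n (fun k => inv_pi_term (S k)) n
  = 1 - 4 / 3 * (INR (S (S n)) * double_fact_ratio (S (S n)) ^ 2)
        * (2 + / (2 * INR (S (S n)) + - 1)).
Proof.
induction n as [|n IH].
- rewrite sum_O, !double_fact_ratio_S, double_fact_ratio_0.
  unfold inv_pi_term; simpl; field.
- rewrite sum_Sn, IH; unfold plus; simpl (AbelianMonoid.plus _ _).
  unfold inv_pi_term; fold (double_fact_ratio (S (S n))).
  rewrite (double_fact_ratio_S (S (S n))), !S_INR.
  simpl; generalize (pos_INR n); intros; field; lra.
Qed.

Lemma is_series_inv_pi_term :
  is_series (fun n => inv_pi_term (S n)) (1 - 8 / 3 * / PI).
Proof.
change (is_lim_seq (sum_n (fun n => inv_pi_term (S n))) (1 - 8 / 3 * / PI)).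
eapply is_lim_seq_ext; [intros n; symmetry; apply sum_inv_pi_term|].
set (u n := 1 - 4 / 3 * (INR n * double_fact_ratio n ^ 2)
                * (2 + / (2 * INR n + - 1))).
(* The closed form is [u (n + 2)]; two shifts reduce the claim to the limit of [u]. *)
apply (is_lim_seq_incr_1 (fun n => u (S n))), (is_lim_seq_incr_1 u); unfold u.
replace (1 - 8 / 3 * / PI) with (1 - 4 / 3 * / PI * (2 + 0)) by lra.
apply is_lim_seq_minus'; [apply is_lim_seq_const|].
apply is_lim_seq_mult'.
- apply is_lim_seq_mult'; [apply is_lim_seq_const | apply wallis_limit].
- apply is_lim_seq_plus'; [apply is_lim_seq_const|].
  apply is_lim_seq_inv_affine.
Qed.

(** Convergence is a separate conjunct because [Series] assigns a value to divergent series too. The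
    shift [S n] makes the sum start at [i = 1]. *)
Theorem mainTheorem3 :
  ex_series (fun n : nat => inv_pi_term (S n)) /\
  1 / PI = 3 / 8 * (1 - Series (fun n : nat => inv_pi_term (S n))).
Proof.
split; [eexists; apply is_series_inv_pi_term|].
rewrite (is_series_unique _ _ is_series_inv_pi_term).
field; apply PI_neq0.
Qed.
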